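(* Let $R$ be a unique factorization domain with field of fractions $K$ and $p=\mathrm{char}(K)$, and let $f\in R[X]$ have degree $d\ge 2$. (i) If $p=0$, then $f$ is special if and only if $f(X)=f_d(X+A)^d+C$ for some $0\ne f_d\in R$ and $A,C\in K$, and $K$ contains a primitive $d$-th root of unity. (ii) If $p>0$, write $d=p^l m$ with $\gcd(m,p)=1$. Then $f$ is special if and only if $$f(X)=f_d\prod_{i=1}^{p^v}(X-b_i+A)^{m p^{l-v}}+C$$ for some $0\ne f_d\in R$, $A,C\in K$, $0\le v\le l$, where $K$ contains a primitive $m$-th root of unity $\zeta$ and $V=\{b_1,\dots,b_{p^v}\}\subset K$ (with $|V|=p^v$) is an $\mathbb{F}_p(\zeta)$-linear subspace of $K$.
   Context: A polynomial $f\in R[X]$ with $\deg f=d\ge 2$ is called special if the polynomial $f(X)-f(Y)$ factors as $\prod_{i=1}^d(a_iX+b_iY+c_i)$ with $a_i,b_i,c_i\in R$. $\mathbb{F}_p$ denotes the prime subfield of $K$ when $p>0$. *)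

(* Defs.v *)
From HB Require Import structures.
From mathcomp Require Import all_boot all_order all_algebra.

Set Implicit Arguments.
Unset Strict Implicit.
Unset Printing Implicit Defensive.

Import GRing.Theory.
Local Open Scope ring_scope.

Section UFD.
Variable R : idomainType.

Definition irreducible_elt (x : R) : Prop :=
  [/\ x != 0, x \isn't a GRing.unit
    & forall a b : R, x = a * b ->
        a \is a GRing.unit \/ b \is a GRing.unit].

Definition associated (x y : R) : Prop :=
  exists2 u : R, u \is a GRing.unit & y = u * x.

Definition irreducible_seq (s : seq R) : Prop :=
  forall x : R, x \in s -> irreducible_elt x.

(* The unit factor covers the units themselves, via s = [::]. *)
Definition has_factorizations : Prop :=
  forall x : R, x != 0 ->
    exists2 s : seq R, irreducible_seq s & associated (\prod_(y <- s) y) x.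

Definition factorizations_unique : Prop :=
  forall s t : seq R, irreducible_seq s -> irreducible_seq t ->
    associated (\prod_(y <- s) y) (\prod_(y <- t) y) ->
    exists2 t' : seq R, perm_eq t' t &
      size s = size t' /\
      forall i : nat, (i < size s)%N -> associated s`_i t'`_i.

Definition is_UFD : Prop := has_factorizations /\ factorizations_unique.

End UFD.

(* In {poly {poly R}}, f(X) is f^:P and f(Y) is f%:P; 'Y stands for 'X%:P. *)
Definition special (R : idomainType) (f : {poly R}) : Prop :=
  let d := (size f).-1 in
  (2 <= d)%N /\
  exists a b c : 'I_d -> R,
    f^:P - f%:P =
      \prod_(i < d) ((a i)%:P%:P * 'X + (b i)%:P%:P * 'Y + (c i)%:P%:P).

Section Subfields.
Variable K : fieldType.

(* The smallest subfield of K containing S; the last rule includes the case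
   y = 0, which is harmless since then x / y = 0. *)
Inductive subfield_gen (S : K -> Prop) : K -> Prop :=
  | subfield_gen_base x : S x -> subfield_gen S x
  | subfield_gen_one : subfield_gen S 1
  | subfield_gen_sub x y :
      subfield_gen S x -> subfield_gen S y -> subfield_gen S (x - y)
  | subfield_gen_div x y :
      subfield_gen S x -> subfield_gen S y -> subfield_gen S (x / y).

Definition prime_subfield : K -> Prop := subfield_gen (fun _ => False).

Definition prime_adjoin (z : K) : K -> Prop :=
  subfield_gen (fun x => prime_subfield x \/ x = z).

Definition linear_subspace (F V : K -> Prop) : Prop :=
  [/\ V 0,
      forall x y : K, V x -> V y -> V (x + y)
    & forall a x : K, F a -> V x -> V (a * x)].

End Subfields.

(* Main.v *)
Require Import Defs.
From mathcomp Require Import all_boot all_order all_algebra.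
From mathcomp Require Import fingroup perm cyclic pgroup abelian separable cyclotomic.

(** Suppose f(X) - f(Y) is a product of linear forms, written over the fraction
    field K as f_d times the product of the X - a_i Y - b_i.  Then f is invariant
    under every affine map Y -> a_i Y + b_i.  Comparing the leading homogeneous
    parts gives X^d - 1 = prod (X - a_i), so some a_i is a primitive m-th root of
    unity z; let y be a fixed point of the corresponding affine map.  Putting
    Y = y shows that f(X) - f(y) has all its roots in y + V, where V is the finite
    group of translations leaving f invariant; by this invariance all the roots
    have the same multiplicity.  V is stable under z, hence an F_p(z)-subspace.

    Conversely, let L = prod_{b in V} (X - b + A).  The polynomial L(X)^m - L(Y)^m
    is monic in X and has the distinct roots z^j (Y + A) + b - A over K[Y], so it
    splits, and so does its Frobenius power.  The factorization descends from K to
    R because a prime of R stays prime in R[Y][X]: the common denominator can be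
    cancelled against the linear forms one prime at a time. *)

Set Implicit Arguments.
Unset Strict Implicit.
Unset Printing Implicit Defensive.

Import GRing.Theory.
Local Open Scope ring_scope.

(** * Divisibility, and primes of a factorial ring *)

Definition divides (R : idomainType) (x y : R) : Prop := exists c, y = x * c.

Definition prime_elt (R : idomainType) (x : R) : Prop :=
  forall a b : R, divides x (a * b) -> divides x a \/ divides x b.

Lemma dividesD (R : idomainType) (x a b : R) :
  divides x a -> divides x b -> divides x (a + b).
Proof. by case=> c -> [e ->]; exists (c + e); rewrite mulrDr. Qed.

Lemma divides_mulr (R : idomainType) (x a b : R) :
  divides x a -> divides x (a * b).
Proof. by case=> c ->; exists (c * b); rewrite mulrA. Qed.

Lemma divides_mull (R : idomainType) (x a b : R) :
  divides x b -> divides x (a * b).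
Proof. by rewrite mulrC; apply: divides_mulr. Qed.

Lemma dividesN (R : idomainType) (x a : R) : divides x a -> divides x (- a).
Proof. by case=> c ->; exists (- c); rewrite mulrN. Qed.

(** Write [a * b = x * c] and factor [a], [b] and [c]: by uniqueness [x] is an associate of an
    irreducible factor of [a] or of [b], hence divides one of them. *)
Lemma UFD_irreducible_prime (R : idomainType) (x : R) :
  is_UFD R -> irreducible_elt x -> prime_elt x.
Proof.
move=> [fac unq] xirr a b [c abxc].
have x0 : x != 0 by case: xirr.
have [->|a0] := eqVneq a 0; first by left; exists 0; rewrite mulr0.
have [->|b0] := eqVneq b 0; first by right; exists 0; rewrite mulr0.
have c0 : c != 0.
  apply: contraNneq (mulf_neq0 a0 b0) => c0.
  by rewrite abxc c0 mulr0.
have [s sirr [u uU aE]] := fac a a0.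
have [t tirr [v vU bE]] := fac b b0.
have [r rirr [w wU cE]] := fac c c0.
have [||| t' pt [szE asc]] := unq (s ++ t) (x :: r).
- by move=> y; rewrite mem_cat => /orP [/sirr|/tirr].
- by move=> y; rewrite inE => /orP [/eqP->|/rirr].
- exists (w^-1 * (u * v)); first by rewrite !unitrM unitrV wU uU.
  rewrite big_cons big_cat /=; apply: (mulrI wU).
  rewrite !mulrA mulrV // mul1r -!mulrA mulrCA -cE -abxc aE bE.
  by rewrite -!mulrA; congr (_ * _); rewrite mulrCA.
have xt' : x \in t' by rewrite (perm_mem pt) inE eqxx.
pose i := index x t'.
have si : (i < size (s ++ t))%N by rewrite szE index_mem.
have [e eU] := asc i si; rewrite /i nth_index // => xE.
have key (q : seq R) : (s ++ t)`_i \in q -> divides x (\prod_(y <- q) y).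
  move=> iq; rewrite (big_rem _ iq) /=; apply: divides_mulr.
  by exists e^-1; rewrite [x in RHS]xE mulrC mulKr.
have := mem_nth 0 si; rewrite mem_cat => /orP [/key|/key] dx.
  by left; rewrite aE; apply: divides_mull.
by right; rewrite bE; apply: divides_mull.
Qed.

Lemma divides_coef (R : idomainType) (x : R) (q : {poly R}) :
  divides x%:P q -> forall i, divides x q`_i.
Proof. by case=> c -> i; exists c`_i; rewrite coefCM. Qed.

(** Gauss's lemma, by induction on the sum of the sizes: [x] divides the leading coefficient of [a]
    or of [b], and removing that leading term leaves a product still divisible by [x]. *)
Lemma prime_elt_polyC (R : idomainType) (x : R) :
  prime_elt x -> prime_elt x%:P.
Proof.
move=> px a b.
have [n] := ubnP (size a + size b); elim: n a b => // n IH a b /ltnSE szn dab.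
have [->|a0] := eqVneq a 0; first by left; exists 0; rewrite mulr0.
have [->|b0] := eqVneq b 0; first by right; exists 0; rewrite mulr0.
have dlead : divides x (lead_coef a * lead_coef b).
  by rewrite -lead_coefM lead_coefE; apply: divides_coef.
have peel (q : {poly R}) : q != 0 -> exists q' : {poly R}, (size q' < size q)%N /\
    q = q' + (lead_coef q)%:P * 'X^((size q).-1).
  move=> q0; exists (q - (lead_coef q)%:P * 'X^((size q).-1)); split; last by rewrite subrK.
  rewrite [X in (_ < X)%N](polySpred q0) ltnS; apply/leq_sizeP => j jq.
  rewrite coefB coefCM coefXn; have [->|jn] := eqVneq j (size q).-1.
    by rewrite mulr1 lead_coefE subrr.
  rewrite mulr0 subr0 nth_default //.
  by rewrite (polySpred q0) ltn_neqAle eq_sym jn.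
have dmono (c : R) k : divides x c -> divides x%:P (c%:P * 'X^k).
  by case=> c' ->; exists (c'%:P * 'X^k); rewrite polyCM mulrA.
have [da|db] := px _ _ dlead.
  have [a' [sa' aE]] := peel a a0.
  have da'b : divides x%:P (a' * b).
    have -> : a' * b = a * b + - ((lead_coef a)%:P * 'X^((size a).-1) * b).
      by rewrite {1}aE mulrDl addrK.
    by apply: dividesD dab (dividesN _); apply: divides_mulr; apply: dmono.
  have [|da'|] := IH a' b _ da'b; last by right.
    by apply: leq_trans szn; rewrite ltn_add2r.
  by left; rewrite aE; apply: dividesD da' (dmono _ _ da).
have [b' [sb' bE]] := peel b b0.
have dab' : divides x%:P (a * b').
  have -> : a * b' = a * b + - (a * ((lead_coef b)%:P * 'X^((size b).-1))).
    by rewrite {1}bE mulrDr addrK.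
  by apply: dividesD dab (dividesN _); apply: divides_mull; apply: dmono.
have [||db'] := IH a b' _ dab'; first by apply: leq_trans szn; rewrite ltn_add2l.
  by left.
by right; rewrite bE; apply: dividesD db' (dmono _ _ db).
Qed.

Lemma prime_elt_prod (R : idomainType) (x : R) n (F : 'I_n.+1 -> R) :
  prime_elt x -> divides x (\prod_i F i) -> exists i, divides x (F i).
Proof.
move=> px; elim: n F => [|n IH] F.
  by rewrite big_ord1; exists ord0.
rewrite big_ord_recl => /px [d0|/IH [i di]]; first by exists ord0.
by exists (lift ord0 i).
Qed.

(** * Linear forms in X and Y, and their descent from the fraction field *)

Definition linear_form (R : idomainType) (l : R * R * R) : {poly {poly R}} :=
  l.1.1%:P%:P * 'X + l.1.2%:P%:P * 'Y + l.2%:P%:P.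

Definition scale_form (R : idomainType) (x : R) (l : R * R * R) :=
  (x * l.1.1, x * l.1.2, x * l.2).

Lemma linear_form_scale (R : idomainType) (x : R) l :
  linear_form (scale_form x l) = x%:P%:P * linear_form l.
Proof. by rewrite /linear_form /= !polyCM !mulrDr !mulrA. Qed.

Lemma divides_linear_form (R : idomainType) (x : R) l :
  divides x%:P%:P (linear_form l) -> exists l', l = scale_form x l'.
Proof.
move=> dl; have dcc i j := divides_coef (divides_coef dl i) j.
have [a aE] := dcc 1 0; have [b bE] := dcc 0 1; have [c cE] := dcc 0 0.
exists (a, b, c); case: l {dl dcc} aE bE cE => [[l1 l2] l3].
rewrite /linear_form /scale_form /= !(coefD, coefCM, coefC, coefX) /=.
by rewrite !(mulr0, mulr1, addr0, add0r) => -> -> ->.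
Qed.

(* Each prime factor of the denominator [w] divides one of the linear forms,
   so [w] can be cancelled one prime at a time. *)
Lemma linear_forms_cancel (R : idomainType) n (F : {poly {poly R}}) (w : R)
    (l : 'I_n.+1 -> R * R * R) :
  is_UFD R -> w != 0 -> w%:P%:P * F = \prod_i linear_form (l i) ->
  exists l' : 'I_n.+1 -> R * R * R, F = \prod_i linear_form (l' i).
Proof.
move=> ufd w0; have [s sirr [u uU ->]] := ufd.1 w w0.
have scale0 (c : R) (k : 'I_n.+1 -> R * R * R) i :
    \prod_j linear_form (if j == i then scale_form c (k i) else k j)
      = c%:P%:P * \prod_j linear_form (k j).
  rewrite (bigD1 i) //= eqxx linear_form_scale [in RHS](bigD1 i) //= mulrA.
  by congr (_ * _); apply: eq_bigr => j /negPf ->.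
elim: s sirr l {w w0} => [|x s IH] sirr l.
  rewrite big_nil mulr1 => FE.
  (* The unit left when no prime remains is absorbed into form 0, which exists because the index
     type is ['I_n.+1]. *)
  exists (fun j => if j == ord0 then scale_form u^-1 (l ord0) else l j).
  by rewrite scale0 -FE mulrA -!polyCM mulVr // mul1r.
rewrite big_cons => FE.
have xirr : irreducible_elt x by apply: sirr; rewrite inE eqxx.
have x0 : x%:P%:P != 0 :> {poly {poly R}} by rewrite !polyC_eq0; case: xirr.
have px := UFD_irreducible_prime ufd xirr.
have [|i /divides_linear_form [l' lE]] :=
    prime_elt_prod (F := fun i => linear_form (l i))
      (prime_elt_polyC (prime_elt_polyC px)).
  by rewrite -FE mulrCA !polyCM -mulrA; exists ((u * \prod_(y <- s) y)%:P%:P * F);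
     rewrite !polyCM.
apply: (IH _ (fun j => if j == i then l' else l j)).
  by move=> y ys; apply: sirr; rewrite inE ys orbT.
apply: (mulfI x0).
rewrite mulrA -!polyCM mulrCA FE -(scale0 x _ i) eqxx.
by apply: eq_bigr => j _; have [->|//] := eqVneq j i; rewrite lE.
Qed.

Lemma fraction_ratio (R : idomainType) (x : {fraction R}) :
  exists n e : R, e != 0 /\ tofrac e * x = tofrac n.
Proof.
elim/quotW: x => r; exists \n_r, \d_r; split; first exact: denom_ratioP.
rewrite -[tofrac \d_r * _]/(FracField.mul (tofrac \d_r) _) !piE; apply/eqmodP.
rewrite /= FracField.equivfE /FracField.mulf.
rewrite !numden_Ratio ?mulf_neq0 ?oner_eq0 ?denom_ratioP //.
by rewrite !mul1r mulr1.
Qed.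

Lemma map_linear_form (R S : idomainType) (g : {rmorphism R -> S}) l :
  map_poly (map_poly g) (linear_form l)
    = linear_form (g l.1.1, g l.1.2, g l.2).
Proof.
by rewrite /linear_form /= !(rmorphD, rmorphM) /= !(map_polyC, map_polyX) /=
  !(map_polyC, map_polyX).
Qed.

Lemma tofrac_inj (R : idomainType) : injective (@tofrac R).
Proof. by move=> x y /eqP; rewrite tofrac_eq => /eqP. Qed.

(** Clear denominators in each form: the product of the denominators times [F] is then a product of
    forms over [R], and that factor is cancelled prime by prime. *)
Lemma linear_forms_descend (R : idomainType) n (F : {poly {poly R}})
    (l : 'I_n.+1 -> {fraction R} * {fraction R} * {fraction R}) :
  is_UFD R -> map_poly (map_poly (@tofrac R)) F = \prod_i linear_form (l i) ->
  exists l' : 'I_n.+1 -> R * R * R, F = \prod_i linear_form (l' i).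
Proof.
move=> ufd FE.
have [g gP] : exists g : 'I_n.+1 -> R * (R * R * R), forall i, (g i).1 != 0 /\
    scale_form (tofrac (g i).1) (l i)
      = (tofrac (g i).2.1.1, tofrac (g i).2.1.2, tofrac (g i).2.2).
  apply: (@fin_all_exists _ (fun=> (R * (R * R * R))%type) (fun i u => u.1 != 0 /\
    scale_form (tofrac u.1) (l i)
      = (tofrac u.2.1.1, tofrac u.2.1.2, tofrac u.2.2))) => i.
  have [n1 [e1 [e10 E1]]] := fraction_ratio (l i).1.1.
  have [n2 [e2 [e20 E2]]] := fraction_ratio (l i).1.2.
  have [n3 [e3 [e30 E3]]] := fraction_ratio (l i).2.
  exists (e1 * e2 * e3, (e2 * e3 * n1, e1 * e3 * n2, e1 * e2 * n3)).
  split; first by rewrite !mulf_neq0.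
  rewrite /scale_form /= !tofracM -E1 -E2 -E3.
  congr (_, _, _); rewrite !mulrA //; congr (_ * _); last by rewrite mulrAC.
  by rewrite -mulrA mulrC.
apply: (@linear_forms_cancel _ _ F (\prod_i (g i).1) (fun i => (g i).2)) => //.
  by apply/prodf_neq0 => i _; case: (gP i).
have inj2 : injective (map_poly (map_poly (@tofrac R))).
  move=> p q /polyP pq; apply/polyP => i; apply/polyP => j.
  by have := congr1 (fun r : {poly _} => r`_j) (pq i); rewrite !coef_map => /tofrac_inj.
apply: inj2; rewrite rmorphM /= FE map_polyC /= map_polyC /=.
rewrite !rmorph_prod -big_split /=; apply: eq_bigr => i _.
by rewrite map_linear_form -(gP i).2 linear_form_scale.
Qed.

(** * Splitting the explicit polynomials into linear forms *)

Lemma perm_map_stable (T : eqType) (g : T -> T) (V : seq T) :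
  uniq V -> injective g -> {in V, forall x, g x \in V} ->
  perm_eq (map g V) V.
Proof.
move=> Vu gi gV; have gVu : uniq (map g V) by rewrite map_inj_uniq.
have sub : {subset map g V <= V} by move=> _ /mapP [x xV ->]; apply: gV.
apply: uniq_perm => //.
by have [|_] := uniq_min_size gVu sub; rewrite ?size_map.
Qed.

Lemma comp_prod (R : comNzRingType) I (r : seq I) (F : I -> {poly R}) u :
  (\prod_(i <- r) F i) \Po u = \prod_(i <- r) (F i \Po u).
Proof. by rewrite (rmorph_prod (comp_poly u)). Qed.

Lemma prod_scale (R : comNzRingType) I (r : seq I) (F : I -> {poly R}) z :
  \prod_(i <- r) (z *: F i) = z ^+ size r *: \prod_(i <- r) F i.
Proof.
elim: r => [|i r IH]; first by rewrite !big_nil scale1r.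
by rewrite !big_cons IH exprS -scalerAl -scalerAr scalerA.
Qed.

(** The substitution sends the factor indexed by [z * c + b] to [z] times the factor indexed by [c],
    and c -> z c + b permutes [V]. *)
Lemma prod_translates_affine (K : fieldType) (V : seq K) (A z b : K) :
  uniq V -> z != 0 -> b \in V ->
  {in V &, forall x y, x + y \in V} -> {in V, forall x, z * x \in V} ->
  (\prod_(c <- V) ('X - c%:P + A%:P)) \Po (z *: ('X + A%:P) + (b - A)%:P)
    = z ^+ size V *: \prod_(c <- V) ('X - c%:P + A%:P).
Proof.
move=> Vu z0 bV VD VZ; rewrite comp_prod.
have pD : perm_eq [seq x + b | x <- V] V.
  by apply: perm_map_stable => //; [apply: addIr | move=> x xV; apply: VD].
have pZ : perm_eq [seq z * x | x <- V] V.
  by apply: perm_map_stable => //; apply: mulfI.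
rewrite -(perm_big _ pD) big_map /= -(perm_big _ pZ) big_map /=.
rewrite -prod_scale; apply: eq_bigr => c _.
rewrite comp_polyD comp_polyB !comp_polyC comp_polyX.
rewrite -!mul_polyC !(mulrDr, polyCD, polyCM, polyCN, mulrN, polyCB).
by rewrite opprD addrACA [b%:P - _]addrC addrK subrK addrAC.
Qed.

(** The leading terms cancel. This keeps the size of a difference at most the number of its known
    roots, so that it must vanish. *)
Lemma size_diff_monic (R : nzRingType) (p q r : {poly R}) (n : nat) :
  p \is monic -> q \is monic -> size p = n.+1 -> size q = n.+1 ->
  (size r <= n)%N -> (size (p - r - q)%R <= n)%N.
Proof.
move=> /monicP pm /monicP qm sp sq sr; apply/leq_sizeP => j.
rewrite !coefB leq_eqVlt => /predU1P [<-|nj].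
  rewrite (nth_default _ sr) subr0; move: pm qm.
  by rewrite !lead_coefE sp sq => -> ->; rewrite subrr.
by rewrite !nth_default ?sp ?sq ?subr0 //; apply: leq_trans sr (ltnW _).
Qed.

(* Both sides are monic in X of the same degree over K[Y], and the right-hand
   side lists distinct roots of the left-hand side. *)
Lemma power_difference_split (K : fieldType) (V : seq K) (A z : K) m :
  m.-primitive_root z -> uniq V -> (0 < size V)%N ->
  {in V &, forall x y, x + y \in V} -> {in V, forall x, z * x \in V} ->
  let L := \prod_(c <- V) ('X - c%:P + A%:P) in
  (L ^+ m)^:P - (L ^+ m)%:P =
    \prod_(r <- [seq z ^+ j *: ('X + A%:P) + (b - A)%:P | j <- iota 0 m, b <- V])
       ('X - r%:P).
Proof.
move=> zp Vu V0 VD VZ L; set rs := [seq _ | j <- _, b <- _].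
have m0 := prim_order_gt0 zp.
have z0 : z != 0.
  by have := oner_neq0 K; rewrite -(prim_expr_order zp) expf_eq0 m0.
have VZj j : {in V, forall x, z ^+ j * x \in V}.
  elim: j => [|j IH] x xV; first by rewrite expr0 mul1r.
  by rewrite exprS -mulrA VZ // IH.
have LE : L = \prod_(c <- V) ('X - (c - A)%:P).
  by apply: eq_bigr => c _; rewrite polyCB opprB [A%:P - _]addrC addrA.
have Lm : L \is monic by rewrite LE monic_prod_XsubC.
have sL : size L = (size V).+1 by rewrite LE size_prod_XsubC.
have sLm : size (L ^+ m) = (m * size V).+1.
  by rewrite (polySpred (monic_neq0 (monic_exp m Lm))) size_exp sL mulnC.
have srs : size rs = (m * size V)%N by rewrite size_allpairs size_iota.
apply/eqP; rewrite -subr_eq0; apply/eqP.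
apply: (@roots_geq_poly_eq0 _ _ rs).
(* Substituting [r] multiplies [L] by z^(j |V|), which the m-th power removes, so L^m(r) = L^m(Y);
   here Y is the variable of the coefficient ring. *)
- apply/allP => _ /allpairsP [[j b] [/= jm bV ->]].
  set r := _ *: _ + _; have /rootP rr : root (\prod_(r <- rs) ('X - r%:P)) r.
    by rewrite root_prod_XsubC; apply/allpairsP; exists (j, b).
  rewrite rootE !(hornerD, hornerN) rr hornerC oppr0 addr0 subr_eq0.
  rewrite -/(comp_poly r (L ^+ m)) rmorphXn /= prod_translates_affine ?expf_neq0 //.
  by rewrite exprZn -!exprM [(_ * m)%N]mulnC exprM (prim_expr_order zp) expr1n scale1r.
- apply: allpairs_uniq => //; first exact: iota_uniq.
  (* The slope z^j determines j < m, and then the constant term determines b. *)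
  move=> [i b] [j c] /allpairsP [[i' b'] [/= im bV [-> ->]]].
  move=> /allpairsP [[j' c'] [/= jm cV [-> ->]]] E.
  have /(congr1 (fun p : {poly K} => p`_1)) := E.
  have /(congr1 (fun p : {poly K} => p`_0)) := E.
  rewrite /= !(coefD, coefZ, coefX, coefC, coefN) /= !(mulr0, add0r, addr0, mulr1).
  move=> E0 /eqP; rewrite (eq_prim_root_expr zp) /eqn.
  move: im jm; rewrite !mem_iota !add0n => im jm.
  rewrite !modn_small // => /eqP ij; move: E0; rewrite ij.
  by move/addrI/addIr => ->.
- rewrite srs; apply: size_diff_monic.
  + by rewrite monic_map // monic_exp.
  + exact: monic_prod_XsubC.
  + by rewrite size_map_polyC.
  + by rewrite size_prod_XsubC srs.
  + by rewrite (leq_trans (size_polyC_leq1 _)) // muln_gt0 m0.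
Qed.

Lemma prod_flatten_nseq (R : comNzRingType) (T : Type) (s : seq T) (F : T -> R) e :
  \prod_(x <- flatten (nseq e s)) F x = (\prod_(x <- s) F x) ^+ e.
Proof. by elim: e => [|e IH]; rewrite ?big_nil //= big_cat IH exprS. Qed.

(** By [frob] the difference for L^(m e) is the e-th power of the one for L^m, so each form is
    repeated [e] times. The exponent [e] will be 1 in characteristic 0 and p^(l - v) in
    characteristic p. *)
Lemma difference_split (K : fieldType) (V : seq K) (c A C z : K) m e :
  m.-primitive_root z -> uniq V -> (0 < size V)%N ->
  {in V &, forall x y, x + y \in V} -> {in V, forall x, z * x \in V} ->
  (forall x y : {poly {poly K}}, (x - y) ^+ e = x ^+ e - y ^+ e) ->
  let g := c%:P * (\prod_(b <- V) ('X - b%:P + A%:P)) ^+ (m * e) + C%:P in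
  exists ls : seq (K * K * K), size ls = (e * (m * size V))%N /\
    g^:P - g%:P = c%:P%:P * \prod_(l <- ls) linear_form l.
Proof.
move=> zp Vu V0 VD VZ frob; set L := \prod_(b <- V) _; move=> g.
(* The forms X - (z^j (Y + A) + b - A). *)
pose ls := [seq (1 : K, - z ^+ j, A - b - z ^+ j * A) | j <- iota 0 m, b <- V].
exists (flatten (nseq e ls)); split.
  by rewrite size_flatten /shape map_nseq sumn_nseq size_allpairs size_iota mulnC.
rewrite /g !rmorphD !rmorphM /= !map_polyC /= opprD addrACA subrr addr0 -mulrBr.
congr (_ * _); rewrite exprM [in LHS]rmorphXn /= [X in _ - X]rmorphXn /= -frob.
rewrite (power_difference_split A zp) // prod_flatten_nseq; congr (_ ^+ _).
rewrite !big_allpairs_dep /=; apply: eq_bigr => j _; apply: eq_bigr => b _.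
rewrite /linear_form /= mul1r -addrA -polyCM -polyCD -polyCN; congr (_ + _%:P).
rewrite -mul_polyC mulrDr -polyCM -addrA -polyCD opprD polyCN mulNr -polyCN.
by congr (_ + _%:P); rewrite opprD opprB addrC.
Qed.

Lemma map_difference (R S : idomainType) (h : {rmorphism R -> S}) (f : {poly R}) :
  map_poly (map_poly h) (f^:P - f%:P) = (map_poly h f)^:P - (map_poly h f)%:P.
Proof.
rewrite rmorphB /= map_polyC /= -!map_poly_comp; congr (_ - _).
by apply: eq_map_poly => x /=; rewrite map_polyC.
Qed.

Lemma special_of_split (R : idomainType) (f : {poly R}) d (c : {fraction R}) ls :
  is_UFD R -> (2 <= d)%N -> size f = d.+1 -> size ls = d ->
  (let g := map_poly (@tofrac R) f in
   g^:P - g%:P = c%:P%:P * \prod_(l <- ls) linear_form l) ->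
  special f.
Proof.
move=> ufd d2 sf sls gE; rewrite /special sf /=; split=> //.
case: d d2 sf sls => // d d2 sf; case: ls gE => // l0 ls gE [sls].
pose l1 := scale_form c l0 :: ls.
have [||l' fE] := @linear_forms_descend R d (f^:P - f%:P) (fun i => nth (0, 0, 0) l1 i).
- by [].
- rewrite map_difference gE big_cons mulrA -linear_form_scale.
  have -> : \prod_(i < d.+1) linear_form (nth (0, 0, 0) l1 i)
      = \prod_(l <- l1) linear_form l.
    by rewrite (big_nth (0, 0, 0)) /= sls big_mkord.
  by rewrite big_cons.
by exists (fun i => (l' i).1.1), (fun i => (l' i).1.2), (fun i => (l' i).2).
Qed.

(** * Slopes of a given splitting, and a primitive root among them *)

Lemma size_index_enum_ord n : size (index_enum 'I_n) = n.
Proof. by rewrite -sum1_size sum_nat_const card_ord muln1. Qed.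

(** Each factor has degree at most 1, so only the X-terms contribute in degree [size s]. *)
Lemma coef_prod_linear (R : nzRingType) (T : Type) (s : seq T) (F : T -> {poly R}) :
  (forall x, size (F x) <= 2)%N ->
  (\prod_(x <- s) F x)`_(size s) = \prod_(x <- s) (F x)`_1.
Proof.
move=> sF; suff [] : (size (\prod_(x <- s) F x)%R <= (size s).+1)%N /\
  (\prod_(x <- s) F x)`_(size s) = \prod_(x <- s) (F x)`_1 by [].
elim: s => [|x s [sP cP]]; first by rewrite !big_nil size_poly1 coef1.
rewrite !big_cons; move: (\prod_(y <- s) F y) sP cP => P sP cP; split.
  apply: leq_trans (size_polyMleq _ _) _.
  by move: (leq_add (sF x) sP); case: (_ + _)%N.
rewrite coefM /= big_ord_recl big_ord_recl big1 => [|i _].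
  by rewrite /= subn0 subn1 /= cP (nth_default _ sP) mulr0 add0r addr0.
by rewrite nth_default ?mul0r // (leq_trans (sF x)).
Qed.

Lemma coef_prod_linear_ord (R : nzRingType) n (F : 'I_n -> {poly R}) :
  (forall i, size (F i) <= 2)%N ->
  (\prod_(i < n) F i)`_n = \prod_(i < n) (F i)`_1.
Proof.
by move/(coef_prod_linear (index_enum 'I_n)); rewrite size_index_enum_ord.
Qed.

(** Specializes X to [u] and Y to [y] in a commutative ring over K: the inner variable is evaluated
    through [phi], then the outer one. *)
Lemma split_horner (K : fieldType) (S : comNzRingType) (iota : {rmorphism K -> S})
    (g : {poly K}) (c : K) n (al be : 'I_n -> K) (u y : S) :
  g^:P - g%:P = c%:P%:P * \prod_i ('X - (al i)%:P%:P * 'Y - (be i)%:P%:P) ->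
  (map_poly iota g).[u] - (map_poly iota g).[y]
    = iota c * \prod_i (u - iota (al i) * y - iota (be i)).
Proof.
have [phi phiE] : exists phi : {rmorphism {poly K} -> S},
    forall p, phi p = (map_poly iota p).[y].
  by exists (horner_eval y \o map_poly iota).
have phiC a : phi a%:P = iota a by rewrite phiE map_polyC hornerC.
have phiX : phi 'X = y by rewrite phiE map_polyX hornerX.
move/(congr1 (fun p => (map_poly phi p).[u])).
rewrite rmorphB rmorphM rmorph_prod /= !map_polyC !hornerE horner_prod.
rewrite -map_poly_comp (eq_map_poly phiC) => E.
rewrite -(phiE g); apply: (etrans E).
congr (_ * _); first exact: phiC.
apply: eq_bigr => i _; rewrite -!phiC -phiX.
by rewrite !rmorphB rmorphM /= map_polyX !map_polyC !hornerE.
Qed.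

(** The X-coefficients of the forms multiply to the leading coefficient of [g], so none vanishes and
    each form can be divided by its own. *)
Lemma normalize_split (K : fieldType) (g : {poly K}) d (l : 'I_d -> K * K * K) :
  (0 < d)%N -> size g = d.+1 -> g^:P - g%:P = \prod_i linear_form (l i) ->
  exists al be : 'I_d -> K,
    g^:P - g%:P
      = (lead_coef g)%:P%:P * \prod_i ('X - (al i)%:P%:P * 'Y - (be i)%:P%:P).
Proof.
move=> d0 sg gE.
have lE : lead_coef g = \prod_i (l i).1.1.
  have := congr1 (fun p : {poly {poly K}} => p`_d) gE.
  rewrite coefB coef_map coefC (negPf (lt0n_neq0 d0)) subr0 /=.
  rewrite coef_prod_linear_ord => [|i].
    rewrite (eq_bigr (fun i => (l i).1.1%:P)) => [|i _]; last first.
      by rewrite /linear_form !(coefD, coefCM, coefC, coefX) mulr1 mulr0 !addr0.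
    by rewrite -rmorph_prod lead_coefE sg => /polyC_inj.
  apply/leq_sizeP => [[|[|j]]] // _.
  by rewrite /linear_form !(coefD, coefCM, coefC, coefX) !mulr0 !addr0.
have nz i : (l i).1.1 != 0.
  have : lead_coef g != 0 by rewrite lead_coef_eq0 -size_poly_eq0 sg.
  by rewrite lE => /prodf_neq0; apply.
exists (fun i => - (l i).1.2 / (l i).1.1), (fun i => - (l i).2 / (l i).1.1).
rewrite gE lE !rmorph_prod -big_split /=; apply: eq_bigr => i _.
rewrite /linear_form !mulrBr mulrA -!polyCM.
by rewrite ![_ * (_ / _)]mulrC !divfK // !(polyCN, mulNr, opprK).
Qed.

Lemma split_slopes (K : fieldType) (g : {poly K}) d (al be : 'I_d -> K) :
  (0 < d)%N -> size g = d.+1 ->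
  g^:P - g%:P
    = (lead_coef g)%:P%:P * \prod_i ('X - (al i)%:P%:P * 'Y - (be i)%:P%:P) ->
  'X^d - 1 = \prod_i ('X - (al i)%:P).
Proof.
move=> d0 sg gE.
have c0 : lead_coef g != 0 by rewrite lead_coef_eq0 -size_poly_eq0 sg.
pose iota : {rmorphism K -> {poly {poly K}}} := polyC \o polyC.
(* Put X = W T and Y = T, with W the inner and T the outer variable; the coefficients of T^d are the
   leading homogeneous parts. *)
have := split_horner iota ('X%:P * 'X) 'X gE.
move/(congr1 (fun p : {poly {poly K}} => p`_d)).
have coefd (w : {poly K}) : ((map_poly iota g).[w%:P * 'X])`_d = (lead_coef g)%:P * w ^+ d.
  have siota : size (map_poly iota g) = d.+1.
    by rewrite size_map_inj_poly ?rmorph0 //; apply: inj_comp; apply: polyC_inj.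
  rewrite horner_coef siota coef_sum big_ord_recr big1 /= => [|i _].
    rewrite add0r coef_map /= exprMn -polyC_exp coefCM coefCM coefXn eqxx mulr1.
    by rewrite lead_coefE sg.
  rewrite coef_map /= exprMn -polyC_exp !coefCM coefXn.
  by rewrite gtn_eqF ?mulr0.
have := coefd 1; rewrite polyC1 mul1r expr1n mulr1 => coefd1.
rewrite coefB coefd coefd1 -[X in _ - X]mulr1 -mulrBr coefCM /=.
have wE i : 'X%:P * 'X - (al i)%:P%:P * 'X - (be i)%:P%:P
    = ('X - (al i)%:P)%:P * 'X - (be i)%:P%:P :> {poly {poly K}}.
  by rewrite polyCB mulrBl.
rewrite coef_prod_linear_ord => [|i].
  move/(mulfI _) => -> //; last by rewrite polyC_eq0.
  apply: eq_bigr => i _.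
  by rewrite wE coefB coefCM coefX coefC mulr1 subr0.
apply/leq_sizeP => [[|[|j]]] // _.
by rewrite wE coefB coefCM coefX coefC mulr0 subr0.
Qed.

(** X^m - 1 divides X^d - 1, hence is up to a unit a product of some of the X - [al i]. It is
    separable because m is nonzero in K, so m distinct m-th roots of unity occur among the [al i],
    and one of them is primitive. *)
Lemma prim_root_of_split (K : fieldType) d q m (al : 'I_d -> K) :
  'X^d - 1 = \prod_i ('X - (al i)%:P) -> d = (m * q)%N -> m%:R != 0 :> K ->
  exists i, m.-primitive_root (al i).
Proof.
move=> dE dqm mK.
have m0 : (0 < m)%N by rewrite lt0n; apply: contraNneq mK => ->.
have : 'X^m - 1 %| \prod_i ('X - (al i)%:P).
  by rewrite -dE dqm exprM -[1 in X in _ %| X](expr1n _ q) subrXX dvdp_mulIl.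
case/dvdp_prod_XsubC => ms; set s := mask _ _.
rewrite -(big_map al predT (fun x => 'X - x%:P)) => eqs.
have su : uniq (map al s).
  rewrite -separable_prod_XsubC -(eqp_separable eqs).
  exact: separable_Xn_sub_1.
have : has m.-primitive_root (map al s).
  apply: has_prim_root => //.
    apply/allP => x xs; rewrite unity_rootE -subr_eq0.
    have : root (\prod_(x <- map al s) ('X - x%:P)) x by rewrite root_prod_XsubC.
    by rewrite -(eqp_root eqs) rootE !hornerE.
  by have := eqp_size eqs; rewrite size_prod_XsubC size_XnsubC // => -[<-].
by case/hasP => _ /mapP [i _ ->] zp; exists i.
Qed.

(** * Affine maps that leave a polynomial invariant *)

Definition affine_invariant (K : fieldType) (g : {poly K}) (a b : K) :=
  g \Po (a *: 'X + b%:P) == g.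

Lemma affine_invariant_comp (K : fieldType) (g : {poly K}) a b a' b' :
  affine_invariant g a b -> affine_invariant g a' b' ->
  affine_invariant g (a * a') (a * b' + b).
Proof.
move=> /eqP i1 /eqP i2; apply/eqP; rewrite -{2}i2 -{2}i1 -comp_polyA.
congr (_ \Po _); rewrite comp_polyD comp_polyZ comp_polyX comp_polyC.
by rewrite scalerDr scalerA polyCD polyCM mul_polyC addrA.
Qed.

Lemma affine_invariant1 (K : fieldType) (g : {poly K}) : affine_invariant g 1 0.
Proof. by rewrite /affine_invariant scale1r addr0 comp_polyXr. Qed.

Lemma affine_invariantN (K : fieldType) (g : {poly K}) b :
  affine_invariant g 1 b -> affine_invariant g 1 (- b).
Proof.
move=> /eqP; rewrite scale1r => i1; apply/eqP.
by rewrite scale1r polyCN -{1}i1 comp_polyXaddC_K.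
Qed.

(** Compare leading coefficients; slope 0 would make [g] constant. *)
Lemma affine_invariant_slope (K : fieldType) (g : {poly K}) d a b :
  (0 < d)%N -> size g = d.+1 -> affine_invariant g a b -> a ^+ d = 1.
Proof.
move=> d0 sg /eqP gi.
have lg0 : lead_coef g != 0 by rewrite lead_coef_eq0 -size_poly_eq0 sg.
have [a0|a0] := eqVneq a 0.
  have := size_polyC_leq1 g.[b].
  rewrite -comp_polyCr; move: gi; rewrite a0 scale0r add0r => ->.
  by rewrite sg ltnNge d0.
have sa : size (a *: 'X + b%:P) = 2.
  by rewrite size_polyDl size_scale ?size_polyX // ltnS size_polyC_leq1.
have := congr1 lead_coef gi; rewrite lead_coef_comp ?sa // sg /=.
rewrite lead_coefDl ?size_scale ?size_polyX ?ltnS ?size_polyC_leq1 //.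
rewrite lead_coefZ lead_coefX mulr1 -[RHS]mulr1.
exact: mulfI.
Qed.

Lemma size_undup_count_const (T : eqType) (s : seq T) N :
  {in s, forall x, count_mem x s = N} -> size s = (size (undup s) * N)%N.
Proof.
move=> sN; rewrite -(perm_size (perm_count_undup s)) size_flatten /shape -map_comp.
rewrite (eq_in_map _ (fun=> N) _).1 => [|x]; last first.
  by rewrite mem_undup => xs /=; rewrite size_nseq sN.
by elim: (undup s) => //= x r ->; rewrite mulSn.
Qed.

(* V is the group of translations leaving g invariant, and - A is the fixed point
   of an invariant affine map of slope z. *)
Lemma form_of_split (K : fieldType) (g : {poly K}) d q m (al be : 'I_d -> K) :
  (0 < d)%N -> size g = d.+1 -> d = (m * q)%N -> m%:R != 0 :> K ->
  (forall x : K, x ^+ q = 1 -> x = 1) ->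
  g^:P - g%:P
    = (lead_coef g)%:P%:P * \prod_i ('X - (al i)%:P%:P * 'Y - (be i)%:P%:P) ->
  exists (z A C : K) (N : nat) (V : seq K),
    [/\ m.-primitive_root z, uniq V /\ d = (size V * N)%N,
        0 \in V /\ {in V &, forall x y, x - y \in V},
        {in V, forall x, z * x \in V}
      & g = (lead_coef g)%:P * (\prod_(b <- V) ('X - b%:P + A%:P)) ^+ N + C%:P].
Proof.
move=> d0 sg dE mK qinj gE.
have lg0 : lead_coef g != 0 by rewrite lead_coef_eq0 -size_poly_eq0 sg.
have [i0 zp] := prim_root_of_split (split_slopes d0 sg gE) dE mK.
set z := al i0 in zp.
have m0 := prim_order_gt0 zp.
(* Putting X = [al i] Y + [be i] kills the i-th factor. *)
have inv_al i : affine_invariant g (al i) (be i).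
  have := split_horner polyC (al i *: 'X + (be i)%:P) 'X gE.
  rewrite (bigD1 i) //= [(al i)%:P * 'X]mul_polyC addrAC addrK subrr mul0r mulr0.
  by move/subr0_eq; rewrite -!/(comp_poly _ _) comp_polyXr => /eqP.
(* (a^m)^q = a^d = 1, and 1 is the only q-th root of 1 in K. *)
have slope a b : affine_invariant g a b -> a ^+ m = 1.
  move=> /(affine_invariant_slope d0 sg); rewrite dE exprM; exact: qinj.
(* [y] is a fixed point of an invariant map of slope [z]; for z = 1 the identity map serves. *)
have [y invz] : exists y, affine_invariant g z (y - z * y).
  have [z1|z1] := eqVneq z 1.
    by exists 0; rewrite z1 mulr0 subrr affine_invariant1.
  exists (be i0 / (1 - z)).
  have z1' : 1 - z != 0 by rewrite subr_eq0 eq_sym.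
  by rewrite -[X in X - _]mul1r -mulrBl mulrCA divff // mulr1 inv_al.
have invzk k : affine_invariant g (z ^+ k) (y - z ^+ k * y).
  elim: k => [|k IH]; first by rewrite expr0 mul1r subrr affine_invariant1.
  have := affine_invariant_comp invz IH; rewrite -exprS.
  by rewrite mulrBr addrC addrA subrK mulrA -exprS.
(* Since [a] is a power of [z], some invariant map fixing [y] has slope 1/a; composing with it
   leaves a translation. *)
have inva a b : affine_invariant g a b -> affine_invariant g 1 (a * y + b - y).
  move=> ainv; have am := slope _ _ ainv.
  have /(prim_rootP zp) [k ak] : a ^+ m = 1 by [].
  have := affine_invariant_comp ainv (invzk (k * m.-1)%N).
  rewrite exprM -ak -exprS prednK // am.
  by rewrite mulrBr mulrA -exprS prednK // am mul1r addrAC.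
(* The roots of g - g(y), shifted by -y and listed with multiplicity. *)
pose s := [seq al i * y + be i - y | i <- index_enum 'I_d].
have sd : size s = d by rewrite size_map size_index_enum_ord.
have gs : g = (lead_coef g)%:P * \prod_(b <- s) ('X - (b + y)%:P) + (g.[y])%:P.
  have := split_horner polyC 'X y%:P gE.
  rewrite horner_map /= -/(comp_poly _ _) comp_polyXr => /eqP.
  rewrite subr_eq => /eqP {1}->; congr (_ * _ + _).
  rewrite big_map; apply: eq_bigr => i _.
  by rewrite subrK polyCD polyCM opprD addrA.
have sinv b : (b \in s) = affine_invariant g 1 b.
  apply/idP/idP => [/mapP [i _ ->]|/eqP gi]; first exact: inva.
  (* Invariance under translation by [b] gives g(y + b) = g(y), so y + b is one of the roots. *)
  have /(congr1 (fun p => p.[y])) := gi.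
  rewrite horner_comp !hornerE {1}gs !hornerE => /eqP.
  rewrite -subr_eq0 addrK mulf_eq0 (negPf lg0) /=.
  rewrite -(big_map (fun x => x + y) predT (fun x => 'X - x%:P)) -rootE.
  rewrite root_prod_XsubC => /mapP [x xs].
  by rewrite addrC => /addIr ->.
clearbody s; have V0 : 0 \in s by rewrite sinv affine_invariant1.
have VB : {in s &, forall x y, x - y \in s}.
  move=> a b; rewrite !sinv => ai /affine_invariantN bi.
  by have := affine_invariant_comp ai bi; rewrite !mul1r addrC.
have VZ : {in s, forall x, z * x \in s}.
  move=> b; rewrite !sinv => bi.
  have := inva _ _ (affine_invariant_comp invz bi); rewrite mulr1.
  by rewrite addrCA [z * y + _]addrC subrK addrK.
have cnt : {in s, forall b, count_mem b s = count_mem 0 s}.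
  move=> b; rewrite sinv => /eqP gi.
  (* Translation by [b] permutes the multiset of roots of g - g(y), and so carries the multiplicity
     of [b] to that of 0. *)
  have : perm_eq [seq x + y - b | x <- s] [seq x + y | x <- s].
    apply: prod_XsubC_eq; rewrite !big_map.
    move: gi; rewrite {1 2}gs comp_polyD comp_polyM !comp_polyC.
    move/addIr => E; have {E} := mulfI _ E; rewrite polyC_eq0 => /(_ lg0) E.
    apply/esym; rewrite -[LHS]E comp_prod; apply: eq_bigr => x _.
    rewrite comp_polyB comp_polyX comp_polyC scale1r.
    by rewrite [in RHS]polyCB opprB addrA addrAC.
  have -> : [seq x + y - b | x <- s] = [seq x + y | x <- [seq x - b | x <- s]].
    by rewrite -map_comp; apply: eq_map => x; rewrite /= addrAC.
  move/(perm_map_inj (addIr y)) => /seq.permP /(_ (pred1 0)) <-.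
  by rewrite count_map; apply: eq_count => x /=; rewrite subr_eq0.
(* The root set is y + V, whence A = -y, and [N] is the common multiplicity. *)
exists z, (- y), g.[y], (count_mem 0 s), (undup s); split=> //.
- by rewrite undup_uniq -[LHS]sd (size_undup_count_const cnt).
- by rewrite mem_undup; split=> // a b; rewrite !mem_undup; apply: VB.
- by move=> b; rewrite !mem_undup; apply: VZ.
rewrite {1}gs -prodrXl; congr (_ * _ + _).
rewrite -prodr_undup_exp_count; apply: eq_big_seq => b.
by rewrite mem_undup => /cnt ->; rewrite polyCN polyCD opprD addrA.
Qed.

(** * Finite additive subgroups of a field, and the scalars that preserve them *)

Lemma size_additive_pchar (K : fieldType) (p : nat) (V : seq K) :
  p \in [pchar K] -> uniq V -> 0 \in V -> {in V &, forall x y, x - y \in V} ->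
  exists v, size V = (p ^ v)%N.
Proof.
move=> pK Vu V0 VB.
have VD : {in V &, forall x y, x + y \in V}.
  by move=> x y xV yV; rewrite -[y]opprK VB // -[- y]add0r VB.
(* [V] acts on itself by translations; [tp] embeds it in the symmetric group as a group of exponent
   dividing p, hence a p-group. *)
pose T := seq_sub V.
pose t (b x : T) : T := SeqSub (VD _ _ (valP x) (valP b)).
have t_inj b : injective (t b).
  by move=> x y /(congr1 val) /= /addIr xy; apply: val_inj.
pose tp b := perm (t_inj b).
have tpE b x : val (tp b x) = val x + val b by rewrite permE.
have tp_inj : injective tp.
  move=> b c /permP /(_ (SeqSub V0)) /(congr1 val); rewrite !tpE /= !add0r.
  exact: val_inj.
have tpM b c : (tp b * tp c)%g = tp (t c b).
  by apply/permP => x; apply: val_inj; rewrite permM !tpE /= addrA.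
have Gg : group_set (tp @: setT).
  apply/group_setP; split.
    apply/imsetP; exists (SeqSub V0) => //.
    by apply/permP => x; apply: val_inj; rewrite perm1 tpE addr0.
  by move=> _ _ /imsetP [b _ ->] /imsetP [c _ ->]; rewrite tpM imset_f.
pose G := Group Gg.
have tpX b n x : val ((tp b ^+ n)%g x) = val x + val b *+ n.
  elim: n => [|n IH]; first by rewrite expg0 perm1 addr0.
  by rewrite expgSr permM tpE IH mulrS -addrA [val b *+ _ + _]addrC.
have pG : (p.-group G)%g.
  rewrite -pnat_exponent; apply: (@pnat_dvd _ p); last first.
    by rewrite pnat_id // (pcharf_prime pK).
  apply/exponentP => _ /imsetP [b _ ->]; apply/permP => x; apply: val_inj.
  by rewrite tpX perm1 -mulr_natr (pcharf0 pK) mulr0 addr0.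
have [v cG] := p_natP pG; exists v.
by rewrite -cG /= card_imset // cardsT card_seq_sub.
Qed.

(** Translation by b in V permutes V; comparing the sums over V gives |V| b = 0, and |V| is nonzero
    in K. *)
Lemma additive_pchar0 (K : fieldType) (V : seq K) :
  [pchar K] =i pred0 -> uniq V -> 0 \in V -> {in V &, forall x y, x - y \in V} ->
  perm_eq V [:: 0].
Proof.
move=> K0 Vu V0 VB; apply: uniq_perm => // b; rewrite inE.
apply/idP/eqP => [bV|->//].
have pB : perm_eq [seq x - b | x <- V] V.
  by apply: perm_map_stable => //; [apply: addIr | move=> x xV; apply: VB].
have : \sum_(x <- V) (x - b) = \sum_(x <- V) x.
  by rewrite -[RHS](perm_big _ pB) big_map.
rewrite big_split /= => /eqP; rewrite -subr_eq0 addrAC subrr add0r.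
rewrite big_const_seq iter_addr_0 count_predT -mulr_natr mulf_eq0 oppr_eq0.
case/orP => [/eqP //|]; rewrite (pcharf0P _).1 // size_eq0 => /eqP VE.
by rewrite VE in bV.
Qed.

(** The scalars preserving [V] form a subfield. For quotients: multiplication by a nonzero b is
    injective on the finite set V, hence bijective, so division by b preserves V too. *)
Lemma subfield_gen_stable (K : fieldType) (S : K -> Prop) (V : seq K) (a : K) :
  uniq V -> 0 \in V -> {in V &, forall x y, x - y \in V} ->
  (forall s, S s -> {in V, forall x, s * x \in V}) ->
  subfield_gen S a -> {in V, forall x, a * x \in V}.
Proof.
move=> Vu V0 VB SV; elim=> [s /SV //|||] {a}.
- by move=> x xV; rewrite mul1r.
- by move=> a b _ aV _ bV x xV; rewrite mulrBl VB ?aV ?bV.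
move=> a b _ aV _ bV x xV; rewrite -mulrA aV //.
have [->|b0] := eqVneq b 0; first by rewrite invr0 mul0r.
have : x \in [seq b * y | y <- V].
  by rewrite (perm_mem (perm_map_stable Vu (mulfI b0) bV)).
by case/mapP => y yV ->; rewrite mulKf.
Qed.

Lemma prime_adjoin_subspace (K : fieldType) (V : seq K) (z : K) :
  uniq V -> 0 \in V -> {in V &, forall x y, x - y \in V} ->
  {in V, forall x, z * x \in V} ->
  linear_subspace (prime_adjoin z) (fun x => x \in V).
Proof.
move=> Vu V0 VB VZ; split=> // [x y xV yV|a x az xV].
  by rewrite -[y]opprK VB // -[- y]add0r VB.
apply: (subfield_gen_stable Vu V0 VB _ az) => // s [sp|->//].
exact: (subfield_gen_stable Vu V0 VB _ sp).
Qed.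

(** * Frobenius powers, passage to the fraction field, and the two cases *)

Lemma exprB_pchar (R : comNzRingType) p k (x y : R) :
  p \in [pchar R] -> (x - y) ^+ (p ^ k) = x ^+ (p ^ k) - y ^+ (p ^ k).
Proof.
move=> pR; have pk : [pchar R].-nat (p ^ k)%N.
  by rewrite (eq_pnat _ (pcharf_eq pR)) pnatX pnat_id ?(pcharf_prime pR).
by rewrite exprDn_pchar // exprNn_pchar.
Qed.

Lemma size_map_tofrac (R : idomainType) (f : {poly R}) :
  size (map_poly (@tofrac R) f) = size f.
Proof. by rewrite size_map_inj_poly ?tofrac0 //; apply: tofrac_inj. Qed.

Lemma lead_coef_map_tofrac (R : idomainType) (f : {poly R}) :
  lead_coef (map_poly (@tofrac R) f) = tofrac (lead_coef f).
Proof. by rewrite !lead_coefE size_map_tofrac coef_map. Qed.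

Lemma split_of_special (R : idomainType) (f : {poly R}) d :
  (0 < d)%N -> size f = d.+1 -> special f ->
  let g := map_poly (@tofrac R) f in
  exists al be : 'I_d -> {fraction R},
    g^:P - g%:P
      = (lead_coef g)%:P%:P * \prod_i ('X - (al i)%:P%:P * 'Y - (be i)%:P%:P).
Proof.
move=> d0 sf; rewrite /special sf /= => -[_ [a [b [c fE]]]].
have := congr1 (map_poly (map_poly (@tofrac R))) fE.
rewrite map_difference rmorph_prod /=.
have lE i : map_poly (map_poly (@tofrac R))
    ((a i)%:P%:P * 'X + (b i)%:P%:P * 'Y + (c i)%:P%:P)
  = linear_form (tofrac (a i), tofrac (b i), tofrac (c i)).
  exact: (map_linear_form _ (a i, b i, c i)).
under eq_bigr do rewrite lE.
by apply: normalize_split => //; rewrite size_map_tofrac.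
Qed.

Lemma special_of_form (R : idomainType) (f : {poly R}) d m e
    (c A C z : {fraction R}) (V : seq {fraction R}) :
  is_UFD R -> (2 <= d)%N -> size f = d.+1 -> d = (e * (m * size V))%N ->
  m.-primitive_root z -> uniq V ->
  {in V &, forall x y, x + y \in V} -> {in V, forall x, z * x \in V} ->
  (forall x y : {poly {poly {fraction R}}}, (x - y) ^+ e = x ^+ e - y ^+ e) ->
  map_poly (@tofrac R) f
    = c%:P * (\prod_(b <- V) ('X - b%:P + A%:P)) ^+ (m * e) + C%:P ->
  special f.
Proof.
move=> ufd d2 sf dE zp Vu VD VZ frob fE.
have V0 : (0 < size V)%N.
  by rewrite lt0n; apply: contraTneq d2 => sV; rewrite dE sV !muln0.
have [ls [sls gE]] := difference_split c A C zp Vu V0 VD VZ frob.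
by apply: (special_of_split ufd d2 sf _ _ (c := c) (ls := ls)); rewrite ?sls ?fE.
Qed.

Theorem theorem1p10 (R : idomainType) (hR : is_UFD R)
    (f : {poly R}) (d : nat) (hd : (2 <= d)%N) (hf : size f = d.+1) :
  ([pchar {fraction R}] =i pred0 ->
     (special f <->
      (exists (fd : R) (A C : {fraction R}),
         fd != 0 /\
         map_poly (@tofrac R) f
           = (tofrac fd)%:P * ('X + A%:P) ^+ d + C%:P) /\
      (exists z : {fraction R}, d.-primitive_root z)))
  /\
  (forall p l m : nat,
     p \in [pchar {fraction R}] -> d = (p ^ l * m)%N -> coprime m p ->
     (special f <->
      exists (fd : R) (A C : {fraction R}) (v : nat) (z : {fraction R})
             (b : 'I_(p ^ v) -> {fraction R}),
        [/\ fd != 0,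
            (v <= l)%N,
            m.-primitive_root z,
            injective b
              /\ linear_subspace (prime_adjoin z) (fun x => exists i, x = b i)
          & map_poly (@tofrac R) f
              = (tofrac fd)%:P *
                (\prod_(i < p ^ v)
                   ('X - (b i)%:P + A%:P) ^+ (m * p ^ (l - v))) + C%:P])).
Proof.
have d0 : (0 < d)%N by apply: leq_trans hd.
have sg : size (map_poly (@tofrac R) f) = d.+1 by rewrite size_map_tofrac.
have lf0 : lead_coef f != 0 by rewrite lead_coef_eq0 -size_poly_eq0 hf.
split=> [K0|p l m pK dE mp].
  split=> [/(split_of_special d0 hf) /= [al [be gE]]|].
    (* Here m = d and q = 1; [V] will be {0}, so that N = d. *)
    have [||z [A [C [N [V [zp [Vu dV] [V0 VB] VZ fE]]]]]] :=
        form_of_split d0 sg (esym (muln1 d)) _ _ gE.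
    - by rewrite (pcharf0P _).1 // -lt0n.
    - by move=> x; rewrite expr1.
    have pV := additive_pchar0 K0 Vu V0 VB.
    split; last by exists z.
    exists (lead_coef f), A, C; split=> //.
    rewrite fE lead_coef_map_tofrac (perm_big _ pV) /= big_seq1 subr0.
    by rewrite dV (perm_size pV) mul1n.
  case=> [[c [A [C [c0 fE]]]] [z zp]].
  (* The zero subspace, with e = 1. *)
  apply: (@special_of_form R f d d 1 (tofrac c) A C z [:: 0]) => //.
  - by rewrite mul1n muln1.
  - by move=> x y; rewrite !inE => /eqP-> /eqP->; rewrite addr0.
  - by move=> x; rewrite !inE => /eqP->; rewrite mulr0.
  - by rewrite fE big_seq1 subr0 muln1.
have pp := pcharf_prime pK.
split=> [/(split_of_special d0 hf) /= [al [be gE]]|].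
  have dE' : d = (m * p ^ l)%N by rewrite dE mulnC.
  (* Here q = p^l, and x^(p^l) = 1 gives (x - 1)^(p^l) = 0, so x = 1. *)
  have [||z [A [C [N [V [zp [Vu dV] [V0 VB] VZ fE]]]]]] :=
      form_of_split d0 sg dE' _ _ gE.
  - by rewrite -(dvdn_pcharf pK) -prime_coprime // coprime_sym.
  - move=> x xp; apply/eqP; rewrite -subr_eq0.
    have : (x - 1) ^+ (p ^ l) == 0 by rewrite (exprB_pchar _ _ _ pK) xp expr1n subrr.
    by rewrite expf_eq0 => /andP [].
  have [v Vv] := size_additive_pchar pK Vu V0 VB.
  (* p^v divides d = p^l m and is coprime to m, so it divides p^l. *)
  have vl : (v <= l)%N.
    rewrite -(dvdn_Pexp2l _ _ (prime_gt1 pp)) -(@Gauss_dvdl _ _ m).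
      by rewrite -dE dV Vv dvdn_mulr.
    by rewrite coprimeXl // coprime_sym.
  have NE : N = (m * p ^ (l - v))%N.
    have pv0 : (0 < p ^ v)%N by rewrite expn_gt0 prime_gt0.
    apply/eqP; rewrite -(eqn_pmul2l pv0) -Vv -dV dE Vv.
    by rewrite mulnCA -expnD subnKC // mulnC.
  have mV x : (exists i : 'I_(p ^ v), x = V`_i) <-> x \in V.
    split=> [[i ->]|xV]; first by rewrite mem_nth // Vv.
    have xi : (index x V < p ^ v)%N by rewrite -Vv index_mem.
    by exists (Ordinal xi); rewrite /= nth_index.
  exists (lead_coef f), A, C, v, z, (fun i => V`_i); split=> //.
    split.
      move=> i j /eqP; rewrite nth_uniq ?Vv // => /eqP ij; exact: val_inj.
    have [W0 WD WZ] := prime_adjoin_subspace Vu V0 VB VZ.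
    split; first exact/mV.
      by move=> x y /mV xV /mV yV; apply/mV; apply: WD.
    by move=> a x az /mV xV; apply/mV; apply: WZ.
  rewrite {1}fE lead_coef_map_tofrac NE prodrXl; congr (_ * _ ^+ _ + _).
  by rewrite (big_nth 0) Vv big_mkord.
case=> c [A [C [v [z [b [c0 vl zp [bi [W0 WD WZ]] fE]]]]]].
pose V := map b (index_enum 'I_(p ^ v)).
have mV x : x \in V <-> exists i, x = b i.
  split=> [/mapP [i _ ->]|[i ->]]; first by exists i.
  by rewrite map_f ?mem_index_enum.
have sV : size V = (p ^ v)%N by rewrite size_map size_index_enum_ord.
(* The exponent e = p^(l - v) is a power of the characteristic, so e-th powers respect
   differences. *)
apply: (@special_of_form R f d m (p ^ (l - v)) (tofrac c) A C z V) => //.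
- by rewrite sV dE mulnCA -expnD subnK // mulnC.
- by rewrite map_inj_uniq ?index_enum_uniq.
- by move=> x y /mV xV /mV yV; apply/mV; apply: WD.
- move=> x /mV xV; apply/mV; apply: WZ => //.
  by apply: subfield_gen_base; right.
- by move=> x y; apply: exprB_pchar; rewrite !pchar_poly.
by rewrite fE prodrXl big_map.
Qed.
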